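(* Let $n\ge k\ge 3$ and let $\mathcal{J}$ be an $S_p(k-1,k,n)$ partial Steiner system. Then there exist signs $(c_J)_{J\in\mathcal{J}}$, complex coefficients $(a_J)_{J\in\mathcal{J}}$, and a constant $A_{k,q}>0$ independent of $n$, such that the $k$-homogeneous polynomial $p=\sum_{J\in\mathcal{J}}c_Ja_Jz_J$ satisfies $$\|p\|_{\mathcal{P}(^k\ell_q^n)}\le A_{k,q}\times\begin{cases}\|a_J\|_\infty\,\log^{\frac{3}{q}}(n)\;n^{\frac{k}{2}\frac{(q-2)}{q}} & \text{for } 2\le q<\infty,\\[4pt] \|a_J\|_\infty\,\log^{\frac{3q-3}{q}}(n) & \text{for } 1\le q\le 2.\end{cases}$$ Moreover, the constant $A_{k,q}$ may be taken independent of $k$ for $q\ne 2$.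
   Context: For integers $1\le t\le k\le n$, an $S_p(t,k,n)$ partial Steiner system is a collection of subsets of $\{1,\dots,n\}$ of cardinality $k$ (called blocks) such that every subset of $\{1,\dots,n\}$ of cardinality $t$ is contained in at most one block of the collection. Signs are numbers $c_J=\pm1$. For a block $J=\{j_1,\dots,j_k\}$ and $z=(z_1,\dots,z_n)\in\mathbb{C}^n$, $z_J=z_{j_1}\cdots z_{j_k}$. The notation $\|a_J\|_\infty$ means $\max_{J\in\mathcal{J}}|a_J|$. For a $k$-homogeneous polynomial $p$ in $n$ complex variables and $1\le q\le\infty$, $\|p\|_{\mathcal{P}(^k\ell_q^n)}=\sup\{|p(z)|: z\in\mathbb{C}^n,\ \|z\|_q\le 1\}$, where $\|\cdot\|_q$ is the $\ell_q$ norm on $\mathbb{C}^n$. *)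

(* Defs.v *)
(* R[i] from real-closed plays the role of the complex numbers over R : realType. *)
From mathcomp Require Import all_boot all_order all_algebra.
From mathcomp Require Import all_classical all_reals all_analysis.
From mathcomp Require Export complex.
Set Implicit Arguments.
Unset Strict Implicit.
Unset Printing Implicit Defensive.
Import Order.TTheory GRing.Theory Num.Theory.
Local Open Scope classical_set_scope.
Local Open Scope ring_scope.
Local Open Scope complex_scope.

(* The ground set {1, ..., n} is rendered as 'I_n. *)
Definition partial_steiner (t k n : nat) (JJ : {set {set 'I_n}}) : Prop :=
  (forall J : {set 'I_n}, J \in JJ -> #|J| = k) /\
  (forall T : {set 'I_n}, #|T| = t ->
     (#|[set J in JJ | T \subset J]%SET| <= 1)%N).

(* normc is the modulus as an element of R (`|x| lives in R[i]). *)
Definition lq_norm (R : realType) (n : nat) (q : R) (z : 'rV[R[i]]_n) : R :=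
  (\sum_(j < n) (Normc.normc (z 0 j)) `^ q) `^ q^-1.

(* The supremum is taken in \bar R, where it needs no boundedness proof: the
   real-valued sup is 0 on unbounded sets. *)
Definition poly_norm (R : realType) (n : nat) (q : R)
    (p : 'rV[R[i]]_n -> R[i]) : \bar R :=
  ereal_sup [set (Normc.normc (p z))%:E | z in [set z | lq_norm q z <= 1]].

Definition monomial (R : realType) (n : nat) (J : {set 'I_n})
    (z : 'rV[R[i]]_n) : R[i] :=
  \prod_(j in J) z 0 j.

(* Equals 0 when JJ is empty. *)
Definition coef_sup_norm (R : realType) (n : nat) (JJ : {set {set 'I_n}})
    (a : {set 'I_n} -> R[i]) : R :=
  \big[Num.max/0]_(J in JJ) Normc.normc (a J).

(* Families indexed by JJ are total functions on {set 'I_n}, only their values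
   on JJ matter. *)
Definition signed_poly (R : realType) (n : nat) (JJ : {set {set 'I_n}})
    (c a : {set 'I_n} -> R[i]) (z : 'rV[R[i]]_n) : R[i] :=
  \sum_(J in JJ) c J * a J * monomial J z.

(* Main.v *)
Require Import Defs.
From mathcomp Require Import all_boot all_order all_algebra.
From mathcomp Require Import all_classical all_reals all_analysis.
From mathcomp Require Import cyclic separable cyclotomic ring lra zify.
Import Order.TTheory GRing.Theory Num.Theory.
Local Open Scope ring_scope.
Local Open Scope complex_scope.
Set Implicit Arguments.
Unset Strict Implicit.
Unset Printing Implicit Defensive.

(** The same random signs are good on the [l_oo] ball (size [n^(k/2)]) and on
    the [l_2] ball (size [log^(3/2) n]), on the [l_1] ball the polynomial is
    small for every choice of signs, and the other exponents follow by
    interpolation.  All coefficients are first scaled to modulus at most 1.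

    Reduction to finitely many points.  The polynomial is affine in each
    variable, so on a polydisc it is controlled, up to a factor [2^k], by its
    values at the points whose coordinates are a radius times a fourth root of
    unity ([polydisc_bound_of_phases]).

    Signs.  [signs_exist] is the union bound for Rademacher sums: if the tests
    [i] have costs [t i] with [\sum_i exp (- t i)] small, one choice of signs
    bounds every test by the square root of its cost times its energy.  The
    torus gives [4^n] tests of cost [4 n] and energy [#|JJ| <= n^(k-1) / k!].

    The [l_2] ball.  Round the moduli of the coordinates up to powers of 2.
    Split the polynomial according to the smallest coordinate in a block, say
    [2^-l].  The part of level [l] depends only on the at most [5 * 4^l]
    coordinates that are at least [2^-l], so its tests cost about [4^l log n].
    Deleting that smallest coordinate from the block leaves a set of size [k-1]
    which lies in no other block, so the energy is at most
    [4^-l * (\sum_j |z_j|^2)^(k-1)] ([level_energy]).  The factors [4^l] and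
    [4^-l] cancel, each level contributes [sqrt (log n)], and there are
    [O(log n)] levels ([good_signs]).

    Interpolation.  A point [z] of the [l_q] ball is dominated by radii
    [4^-(e_j / q)] with integers [e_j] such that [\sum_j 4^-(e_j)] is bounded.
    For [|u_j| <= 1] the map [w |-> p (w^(e_j) u_j)] is a polynomial in one
    variable, and moving to another exponent [q] amounts to changing [|w|].  A three circles
    inequality with a constant depending only on the interpolation parameter
    ([three_circles]) is obtained from bounds on the coefficients.

    Uniformity in [k].  All losses are of the form [C^k], while the [l_oo] and
    [l_1] bounds carry factors [k!^(-1/2)] and [1/k!].  Unless [q = 2], a
    positive power of one of them survives interpolation and absorbs [C^k]
    ([exp_growth_le_factorial]). *)

Import Normc.
Local Notation Re := complex.Re.
Local Notation Im := complex.Im.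

(** * Values at fourth roots of unity control a polydisc *)

Section Modulus.
Variable R : realType.
Implicit Types x y : R[i].

Lemma normcE_sqr x : normc x ^+ 2 = Re x ^+ 2 + Im x ^+ 2.
Proof. by case: x => a b /=; rewrite sqr_sqrtr // addr_ge0 ?sqr_ge0. Qed.

Lemma normc_ge0 x : 0 <= normc x.
Proof. by case: x => a b; rewrite sqrtr_ge0. Qed.

Lemma normc_real (r : R) : normc r%:C = `|r|.
Proof. by rewrite /= expr0n addr0 sqrtr_sqr. Qed.

Lemma normc_i : normc ('i : R[i]) = 1.
Proof. by rewrite /= expr0n add0r expr1n sqrtr1. Qed.

Lemma normcX x m : normc (x ^+ m) = normc x ^+ m.
Proof. by elim: m => [|m IH]; rewrite ?expr0 ?normc1 // !exprS normcM IH. Qed.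

Lemma normc_prod (I : Type) (s : seq I) (P : pred I) (F : I -> R[i]) :
  normc (\prod_(i <- s | P i) F i) = \prod_(i <- s | P i) normc (F i).
Proof. by apply: (big_morph (@normc R)); [exact: normcM | exact: normc1]. Qed.

Lemma normc_sum_le (I : Type) (s : seq I) (P : pred I) (F : I -> R[i]) :
  normc (\sum_(i <- s | P i) F i) <= \sum_(i <- s | P i) normc (F i).
Proof.
apply: (big_ind2 (fun (u : R[i]) (v : R) => normc u <= v)) => //.
  by rewrite normc0.
move=> u1 v1 u2 v2 h1 h2; apply: le_trans (le_normcD _ _) _.
exact: lerD.
Qed.

Lemma Re_normc_le x : `|Re x| <= normc x.
Proof.
rewrite -(ler_pXn2r (n := 2)) // ?nnegrE ?normr_ge0 ?normc_ge0 //.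
by rewrite real_normK ?num_real // normcE_sqr lerDl sqr_ge0.
Qed.

Lemma Im_normc_le x : `|Im x| <= normc x.
Proof.
rewrite -(ler_pXn2r (n := 2)) // ?nnegrE ?normr_ge0 ?normc_ge0 //.
by rewrite real_normK ?num_real // normcE_sqr lerDr sqr_ge0.
Qed.

End Modulus.

Definition multiform (R : realType) (n : nat) (JJ : {set {set 'I_n}})
    (b : {set 'I_n} -> R[i]) (z : 'rV[R[i]]_n) : R[i] :=
  \sum_(J in JJ) b J * monomial J z.

Definition k_uniform (k n : nat) (JJ : {set {set 'I_n}}) : Prop :=
  forall J, J \in JJ -> #|J| = k.

Section Phases.
Variables (R : realType) (n k : nat).
Implicit Types (JJ : {set {set 'I_n}}) (b : {set 'I_n} -> R[i]).
Implicit Types (z : 'rV[R[i]]_n).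

Lemma normc_monomial (J : {set 'I_n}) z :
  normc (monomial J z) = \prod_(j in J) normc (z 0 j).
Proof. exact: normc_prod. Qed.

Lemma multiform_scale JJ b (s : 'I_n -> R[i]) z :
  multiform JJ b (\row_j (s j * z 0 j)) =
  \sum_(J in JJ) (\prod_(j in J) s j) * (b J * monomial J z).
Proof.
apply: eq_bigr => J _; rewrite /monomial mulrCA; congr (_ * _).
by rewrite -big_split; apply: eq_bigr => j _; rewrite mxE.
Qed.

(** Barycentric weights on the four points [1], ['i], [-1], [-'i], chosen so
    that their barycentre is [u]. *)
Definition phase_weight (u : R[i]) (w : 'I_4) : R :=
  4^-1 + 2^-1 * (if w == 0 :> nat then Re u else if w == 1%N :> nat then Im u
          else if w == 2%N :> nat then - Re u else - Im u).

Lemma phase_weight_ge0 u w : normc u <= 2^-1 -> 0 <= phase_weight u w.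
Proof.
move=> hu; have := le_trans (Re_normc_le u) hu.
have := le_trans (Im_normc_le u) hu; rewrite !ler_norml /phase_weight.
by move=> /andP[a1 a2] /andP[a3 a4]; do ?[case: ifP => _]; lra.
Qed.

Lemma phase_weight_sum u : \sum_w phase_weight u w = 1.
Proof. by rewrite !big_ord_recl big_ord0 /phase_weight /=; lra. Qed.

Lemma phase_weight_mean u :
  \sum_w (phase_weight u w)%:C * 'i ^+ w = u.
Proof.
rewrite !big_ord_recl big_ord0 /phase_weight /= /bump /=.
case: u => x y; apply/eqP; rewrite eq_complex /=.
by apply/andP; split; apply/eqP; rewrite /=; field.
Qed.

Definition phase_point (r : 'I_n -> R) (w : {ffun 'I_n -> 'I_4}) : 'rV[R[i]]_n :=
  \row_j ((r j)%:C * 'i ^+ w j).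

(** A square-free monomial sees each variable at most once, so averaging over
    independent random phases replaces every phase by its mean. *)
Lemma multiform_phase_average JJ b (r : 'I_n -> R) (u : 'I_n -> R[i]) :
  multiform JJ b (\row_j ((r j)%:C * u j)) =
  \sum_(w : {ffun 'I_n -> 'I_4})
     (\prod_j phase_weight (u j) (w j))%:C * multiform JJ b (phase_point r w).
Proof.
under [RHS]eq_bigr do rewrite mulr_sumr.
rewrite exchange_big /=; apply: eq_bigr => J _.
under [RHS]eq_bigr do rewrite mulrCA.
rewrite -mulr_sumr; congr (_ * _).
transitivity (\prod_j \sum_(x : 'I_4) ((phase_weight (u j) x)%:C *
    (if j \in J then (r j)%:C * 'i ^+ x else 1))).
  rewrite /monomial big_mkcond /=; apply: eq_bigr => j _; rewrite mxE.
  case: ifP => _.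
    under eq_bigr do rewrite mulrCA.
    by rewrite -mulr_sumr phase_weight_mean.
  under eq_bigr do rewrite mulr1.
  by rewrite -raddf_sum phase_weight_sum.
rewrite bigA_distr_bigA /=; apply: eq_bigr => w _.
rewrite big_split /= rmorph_prod; congr (_ * _).
rewrite /monomial [RHS]big_mkcond /=; apply: eq_bigr => j _.
by rewrite mxE.
Qed.

(** Half of the unit disc lies in the region where the weights [phase_weight]
    are nonnegative; halving all the variables costs [2 ^+ k] by homogeneity. *)
Lemma polydisc_bound_of_phases JJ b (r : 'I_n -> R) (B : R) :
  k_uniform k JJ -> (forall j, 0 <= r j) ->
  (forall w, normc (multiform JJ b (phase_point r w)) <= B) ->
  forall z, (forall j, normc (z 0 j) <= r j) ->
    normc (multiform JJ b z) <= 2 ^+ k * B.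
Proof.
move=> hk r0 hB z hz.
pose u j := ((2 * r j)^-1)%:C * z 0 j.
have hu j : normc (u j) <= 2^-1.
  rewrite /u normcM normc_real ger0_norm ?invr_ge0 ?mulr_ge0 // invfM -mulrA.
  rewrite ler_piMr // mulrC; have := r0 j; rewrite le_eqVlt => /orP[/eqP<-|rj].
    by rewrite invr0 mulr0.
  by rewrite ler_pdivrMr // mul1r.
have -> : z = \row_j (2%:C * (\row_j ((r j)%:C * u j)) 0 j).
  apply/rowP => j; rewrite !mxE /u !mulrA -!rmorphM /=.
  have := r0 j; rewrite le_eqVlt => /orP[/eqP r_0|rj].
    have := hz j; rewrite -r_0 => z0.
    have /eq0_normc -> : normc (z 0 j) = 0.
      by apply/eqP; rewrite eq_le z0 normc_ge0.
    by rewrite mulr0.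
  by rewrite mulfV ?mul1r ?mulf_neq0 ?gt_eqF.
rewrite multiform_scale; under eq_bigr => J hJ.
  rewrite prodr_const (hk _ hJ); over.
rewrite -mulr_sumr normcM normcX normc_real gtr0_norm // ler_pM2l ?exprn_gt0 //.
rewrite -/(multiform _ _ _) multiform_phase_average.
apply: le_trans (normc_sum_le _ _ _) _.
have -> : B = \sum_(w : {ffun 'I_n -> 'I_4}) (\prod_j phase_weight (u j) (w j)) * B.
  rewrite -mulr_suml -(bigA_distr_bigA (fun j x => phase_weight (u j) x)) /=.
  by rewrite big1 ?mul1r // => j _; rewrite phase_weight_sum.
apply: ler_sum => w _.
have hw : 0 <= \prod_j phase_weight (u j) (w j).
  by apply: prodr_ge0 => j _; apply: phase_weight_ge0.
by rewrite normcM normc_real ger0_norm // ler_wpM2l.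
Qed.
End Phases.

(** * A three circles inequality *)

Lemma powR_split (R : realType) (th x : R) : 0 < x -> x = x `^ (1 - th) * x `^ th.
Proof.
by move=> x0; rewrite -powRD ?(lt0r_neq0 x0) ?implybT // subrK powRr1 ?ltW.
Qed.

Section Circles.
Variables (R : realType) (n : nat).
Implicit Types (JJ : {set {set 'I_n}}) (b : {set 'I_n} -> R[i]).
Implicit Types (z : 'rV[R[i]]_n) (e : 'I_n -> nat).

Lemma primitive_root_exists N : (0 < N)%N -> exists x : R[i], N.-primitive_root x.
Proof.
move=> N0; pose p : {poly R[i]} := 'X^N - 1.
have [s Dp] := closed_field_poly_normal p.
rewrite (monicP _) ?monicXnsubC // scale1r in Dp.
have s1 : all N.-unity_root s by apply/allP=> x; rewrite -root_prod_XsubC -Dp.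
have sz : (N < (size s).+1)%N.
  by rewrite -(size_prod_XsubC s id) -Dp size_XnsubC.
have [|x _ hx] := hasP (has_prim_root N0 s1 _ sz); last by exists x.
by rewrite -separable_prod_XsubC -Dp separable_Xn_sub_1 // pnatr_eq0 -lt0n.
Qed.

Lemma primitive_root_sum N (x : R[i]) d : N.-primitive_root x ->
  \sum_(s < N) x ^+ (s * d) = if (N %| d)%N then N%:R else 0.
Proof.
move=> hx; under eq_bigr do rewrite mulnC exprM.
rewrite (prim_order_dvd hx); case: eqP => [->|/eqP h].
  by under eq_bigr do rewrite expr1n; rewrite sumr_const card_ord.
apply/eqP; have /eqP := subrX1 (x ^+ d) N.
rewrite exprAC (prim_expr_order hx) expr1n subrr eq_sym mulf_eq0 subr_eq0.
by rewrite (negPf h).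
Qed.

Definition block_weight e (J : {set 'I_n}) := (\sum_(j in J) e j)%N.

(** The coefficient of [w ^+ m] in the polynomial [w |-> p (w ^+ e j * z j)]. *)
Definition component JJ b e m z : R[i] :=
  \sum_(J in JJ | block_weight e J == m) b J * monomial J z.

Lemma normc_primitive_root N (x : R[i]) : N.-primitive_root x -> normc x = 1.
Proof.
move=> hx; apply/eqP; rewrite -(@eqrXn2 _ N) ?(prim_order_gt0 hx) ?normc_ge0 //.
by rewrite -normcX (prim_expr_order hx) normc1 expr1n.
Qed.

(** Cauchy's estimate for a coefficient of a polynomial in one variable, by
    averaging over the [N]-th roots of unity for a large [N]. *)
Lemma component_bound JJ b e (rho t B : R) m : 0 < rho -> 0 < t ->
  (forall z, (forall j, normc (z 0 j) <= rho ^+ e j) ->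
     normc (multiform JJ b z) <= B) ->
  forall z, (forall j, normc (z 0 j) <= t ^+ e j) ->
    normc (component JJ b e m z) <= (t / rho) ^+ m * B.
Proof.
move=> rho0 t0 hB z hz.
pose N := ((\sum_j e j) + m).+1.
have [x hx] := @primitive_root_exists N isT.
have nx := normc_primitive_root hx.
pose y (s : nat) := \row_j ((x ^+ s * (rho / t)%:C) ^+ e j * z 0 j).
have hy s : normc (multiform JJ b (y s)) <= B.
  apply: hB => j; rewrite mxE normcM !normcX normcM normcX nx expr1n mul1r.
  rewrite normc_real gtr0_norm ?divr_gt0 // expr_div_n mulrAC -mulrA.
  by rewrite ler_piMr ?exprn_ge0 ?(ltW rho0) // ler_pdivrMr ?exprn_gt0 // mul1r.
have key : \sum_(s < N) x ^+ (s * (N - m)) * multiform JJ b (y s) =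
    N%:R * (rho / t)%:C ^+ m * component JJ b e m z.
  under eq_bigr do rewrite multiform_scale mulr_sumr.
  rewrite exchange_big /= /component [in RHS]big_mkcondr /= mulr_sumr.
  apply: eq_bigr => J _.
  have hJ : (block_weight e J <= \sum_j e j)%N.
    by rewrite /block_weight big_mkcond /=; apply: leq_sum => j _; case: ifP.
  under eq_bigr => s _.
    rewrite mulrA prodrXr -/(block_weight e J) exprMn -exprM.
    rewrite [x ^+ _ * (_ * _)]mulrA -exprD -mulnDr.
    rewrite -mulrA; over.
  rewrite -mulr_suml (primitive_root_sum _ hx).
  have -> : (N %| N - m + block_weight e J)%N = (block_weight e J == m).
    apply/idP/eqP => [/dvdnP[c hc]|->].
      have : c = 1%N by rewrite /N in hc *; nia.
      by move=> c1; rewrite c1 /N in hc; lia.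
    by rewrite subnK // /N; lia.
  case: eqP => [->|_]; last by rewrite mul0r mulr0.
  by rewrite mulrA.
have N0 : 0 < (N%:R : R) by rewrite ltr0n.
have h : N%:R * ((rho / t) ^+ m * normc (component JJ b e m z)) <= N%:R * B.
  have -> : N%:R * ((rho / t) ^+ m * normc (component JJ b e m z)) =
      normc (\sum_(s < N) x ^+ (s * (N - m)) * multiform JJ b (y s)).
    rewrite key !normcM normcX normc_real gtr0_norm ?divr_gt0 // mulrA.
    congr (_ * _ * _).
    have -> : (N%:R : R[i]) = (N%:R : R)%:C by rewrite rmorph_nat.
    by rewrite normc_real ger0_norm.
  apply: le_trans (normc_sum_le _ _ _) _.
  rewrite mulr_natl -[N in B *+ N]card_ord -sumr_const; apply: ler_sum => s _.
  by rewrite normcM normcX nx expr1n mul1r.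
rewrite ler_pM2l // in h.
rewrite -[t / rho]invf_div exprVn mulrC ler_pdivlMr ?exprn_gt0 ?divr_gt0 //.
by rewrite mulrC.
Qed.

Lemma multiform_components JJ b e z :
  multiform JJ b z = \sum_(m < (\sum_j e j).+1) component JJ b e m z.
Proof.
rewrite /multiform (partition_big (fun J => inord (block_weight e J) :
  'I_(\sum_j e j).+1) xpredT) //=; apply: eq_bigr => m _.
apply: eq_bigl => J; congr (_ && _).
have hJ : (block_weight e J < (\sum_j e j).+1)%N.
  by rewrite ltnS /block_weight big_mkcond /=; apply: leq_sum => j _; case: ifP.
by rewrite -val_eqE /= inordK.
Qed.

Lemma geometric_sum_le (h : R) N : 0 <= h < 1 -> \sum_(m < N) h ^+ m <= (1 - h)^-1.
Proof.
move=> /andP[h0 h1]; rewrite -[leRHS]mul1r ler_pdivlMr ?subr_gt0 //.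
have -> : (\sum_(m < N) h ^+ m) * (1 - h) = 1 - h ^+ N.
  by rewrite -[in RHS]opprB subrX1; ring.
by rewrite gerBl exprn_ge0.
Qed.

Lemma geometric_tail_le (h : R) M N : 0 <= h < 1 ->
  \sum_(m < N) (if (M <= m)%N then h ^+ (m - M) else 0) <= (1 - h)^-1.
Proof.
move=> h01; apply: le_trans (geometric_sum_le (N - M) h01).
elim: N => [|N IH]; first by rewrite !big_ord0.
rewrite big_ord_recr /=; case: leqP => hM; last first.
  rewrite addr0 (le_trans IH) // (eqP (ltnW hM : (N - M == 0)%N)).
  by rewrite (eqP (hM : (N.+1 - M == 0)%N)).
by rewrite subSn // big_ord_recr lerD.
Qed.

Lemma geometric_head_le (h : R) M N : 0 <= h < 1 ->
  \sum_(m < N) (if (m < M)%N then h ^+ (M.-1 - m) else 0) <= (1 - h)^-1.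
Proof.
move=> h01; apply: le_trans (geometric_sum_le M h01).
have /andP[h0 _] := h01.
elim: N M => [|N IH] M; first by rewrite big_ord0 sumr_ge0 // => i _; rewrite exprn_ge0.
rewrite big_ord_recl; case: M => [|M].
  by rewrite big_ord0 add0r big1.
rewrite big_ord_recr /= subn0 [leLHS]addrC lerD2r.
apply: le_trans (IH M); apply: ler_sum => i _; rewrite /bump /= ltnS.
by case: ltnP => // hi; rewrite -subn1 -subnDA addnC.
Qed.

Definition three_circles_const (th : R) : R :=
  (1 - 2 `^ (- th))^-1 + (1 - 2 `^ (th - 1))^-1.

Lemma two_powR_lt1 (x : R) : 0 < x -> 2 `^ (- x) < 1.
Proof.
move=> x0; have : (1 : R) `^ x < 2 `^ x.
  by apply: gt0_ltr_powR => //; rewrite ?nnegrE ?ler01 ?ler0n ?ltr1n.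
by rewrite powR1 powRN => h; rewrite invf_lt1 ?powR_gt0.
Qed.

(** The component [m] is bounded by [B0 * 2^(- th m)] and by
    [B1 * 2^((1 - th) m)].  The two bounds cross at some [M], where both are
    about [B0^(1 - th) * B1^th], and on either side of [M] the smaller one decays
    geometrically.  Hence the sum costs only a constant that depends on [th],
    whatever the number of components. *)
Lemma three_circles JJ b e (rho th B0 B1 : R) :
  0 < rho -> 0 < th < 1 -> 0 < B0 -> 0 < B1 ->
  (forall z, (forall j, normc (z 0 j) <= rho ^+ e j) ->
     normc (multiform JJ b z) <= B0) ->
  (forall z, (forall j, normc (z 0 j) <= (rho / 2) ^+ e j) ->
     normc (multiform JJ b z) <= B1) ->
  forall z, (forall j, normc (z 0 j) <= (rho * 2 `^ (- th)) ^+ e j) ->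
    normc (multiform JJ b z) <=
      three_circles_const th * (B0 `^ (1 - th) * B1 `^ th).
Proof.
move=> rho0 /andP[th0 th1] B00 B10 h0 h1 z hz.
have two0 : 0 < (2 : R) by [].
set g0 := 2 `^ (- th) in hz *; set g1 := 2 `^ (th - 1).
have g00 : 0 < g0 by apply: powR_gt0.
have g10 : 0 < g1 by apply: powR_gt0.
have g0lt : g0 < 1 by apply: two_powR_lt1.
have g1lt : g1 < 1 by rewrite /g1 -opprB; apply: two_powR_lt1; rewrite subr_gt0.
have g01 : g0 * g1 = 2^-1.
  by rewrite /g0 /g1 -powRD ?pnatr_eq0 ?implybT //;
     have -> : - th + (th - 1) = -1 by [ring]; rewrite powR_inv1.
set K := B0 `^ (1 - th) * B1 `^ th.
have bound0 m : normc (component JJ b e m z) <= g0 ^+ m * B0.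
  have := component_bound m rho0 (mulr_gt0 rho0 g00) h0 hz.
  by rewrite mulrAC mulfV ?gt_eqF // mul1r.
have bound1 m : normc (component JJ b e m z) <= (g1 ^+ m)^-1 * B1.
  have := component_bound m (divr_gt0 rho0 two0) (mulr_gt0 rho0 g00) h1 hz.
  suff -> : rho * g0 / (rho / 2) = g1^-1 by rewrite exprVn.
  have -> : g1^-1 = 2 * g0.
    apply: (mulIf (lt0r_neq0 g10)); rewrite mulVf ?gt_eqF // -mulrA g01 mulfV //.
  by field; rewrite gt_eqF.
have powX (x : R) m : (2 ^+ m) `^ x = (2 `^ x) ^+ m.
  by rewrite -powR_mulrn // powRAC powR_mulrn ?powR_ge0.
(* [M] is the index from which the bound by [B0] is the smaller one. *)
have [M hM Mmin] : exists2 M, B0 <= B1 * 2 ^+ M &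
    forall m, (m < M)%N -> B1 * 2 ^+ m < B0.
  have ex : exists m, B0 <= B1 * 2 ^+ m.
    exists (Num.bound (B0 / B1)); rewrite mulrC -ler_pdivrMr //.
    apply: le_trans (ltW (archi_boundP _)) _; first by rewrite divr_ge0 ?ltW.
    by rewrite -natrX ler_nat ltnW // ltn_expl.
  exists (ex_minn ex); case: ex_minnP => // M hM Mmin m.
  by rewrite ltnNge ltNge; apply: contra => /Mmin.
have high : g0 ^+ M * B0 <= K.
  rewrite {1}(powR_split th (x := B0)) // mulrCA /K ler_wpM2l ?powR_ge0 //.
  rewrite /g0 powRN exprVn -powX mulrC ler_pdivrMr ?powR_gt0 ?exprn_gt0 //.
  rewrite -powRM ?exprn_ge0 ?(ltW B00) ?(ltW B10) // ge0_ler_powR ?nnegrE //.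
  - exact: ltW.
  - exact: ltW.
  - by rewrite mulr_ge0 ?exprn_ge0 ?ltW.
have low m : (m < M)%N -> (g1 ^+ m)^-1 * B1 <= g1 ^+ (M.-1 - m) * K.
  move=> mM; have M0 := leq_ltn_trans (leq0n m) mM.
  have hM2 : (m <= M.-1)%N by rewrite -ltnS prednK.
  have h : (g1 ^+ M.-1)^-1 * B1 <= K.
    rewrite {1}(powR_split th (x := B1)) // mulrA /K ler_wpM2r ?powR_ge0 //.
    have -> : (g1 ^+ M.-1)^-1 = (2 ^+ M.-1) `^ (1 - th).
      by rewrite powX -exprVn /g1 -powRN opprB.
    rewrite -powRM ?exprn_ge0 ?(ltW B00) ?(ltW B10) // ge0_ler_powR ?nnegrE //.
    - by rewrite subr_ge0 ltW.
    - by rewrite mulr_ge0 ?exprn_ge0 ?ltW.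
    - exact: ltW.
    - by rewrite mulrC ltW ?Mmin ?prednK.
  apply: le_trans (ler_wpM2l (exprn_ge0 _ (ltW g10)) h).
  rewrite mulrA ler_wpM2r ?(ltW B10) // -[in leRHS](subnK hM2) addnK exprD invfM mulrA.
  by rewrite mulfV ?mul1r ?expf_neq0 ?gt_eqF.
rewrite (multiform_components _ _ e); apply: le_trans (normc_sum_le _ _ _) _.
set N := (\sum_j e j).+1.
have K0 : 0 <= K by rewrite mulr_ge0 ?powR_ge0.
have tailbound m : normc (component JJ b e m z) <=
    (if (m < M)%N then g1 ^+ (M.-1 - m) else 0) * K +
    (if (M <= m)%N then g0 ^+ (m - M) else 0) * K.
  case: ltnP => mM; last first.
    rewrite mul0r add0r; apply: le_trans (bound0 m) _.
    rewrite -[in g0 ^+ m](subnK mM) exprD -mulrA.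
    by rewrite ler_wpM2l ?exprn_ge0 ?(ltW g00).
  rewrite mul0r addr0; exact: le_trans (bound1 m) (low _ mM).
apply: le_trans (ler_sum _ (fun (m : 'I_N) _ => tailbound m)) _.
rewrite big_split /= -!mulr_suml -mulrDl ler_wpM2r // /three_circles_const [leRHS]addrC.
by rewrite lerD ?geometric_head_le ?geometric_tail_le // ltW.
Qed.
End Circles.

(** * Choosing signs *)

Section Signs.
Variable R : realType.

Definition cosh (x : R) : R := (expR x + expR (- x)) / 2.

(** For small [x], [expR x <= (1 - x)^-1] gives [cosh x <= (1 - x^2)^-1]; for
    large [x], [cosh x <= expR `|x|] is enough. *)
Lemma cosh_le_expR_sqr x : cosh x <= expR (2 * x ^+ 2).
Proof.
have h0 (y : R) : expR y * (1 - y) <= 1.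
  have := expR_ge1Dx (- y); rewrite expRN => h.
  rewrite -[leRHS](mulfV (lt0r_neq0 (expR_gt0 y))) ler_pM2l ?expR_gt0 //.
rewrite /cosh ler_pdivrMr //; have [hx|hx] := leP (x ^+ 2) (2^-1).
  have hp := h0 x; have hm := h0 (- x); rewrite opprK in hm.
  have hq := h0 (- (2 * x ^+ 2)).
  have h1 := expR_ge1Dx (2 * x ^+ 2).
  set a := expR x in hp *; set b := expR (- x) in hm *.
  set c := expR (2 * x ^+ 2) in h1 *.
  have x1 : `|x| < 1.
    by rewrite -(@ltr_pXn2r _ 2) ?nnegrE // real_normK ?num_real // expr1n; lra.
  move: x1; rewrite ltr_norml => /andP[x1 x2].
  have hs : (a + b) * (1 - x ^+ 2) <= 2.
    have -> : (a + b) * (1 - x ^+ 2) = a * (1 - x) * (1 + x) + b * (1 + x) * (1 - x) by ring.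
    nra.
  rewrite -(ler_pM2r (x := 1 - x ^+ 2)); last by lra.
  apply: le_trans hs _; nra.
have hx2 : `|x| <= 2 * x ^+ 2.
  have := sqr_ge0 (`|x| - 2^-1); rewrite -[x ^+ 2]real_normK ?num_real // in hx *.
  by have := normr_ge0 x; nra.
have hp : expR x <= expR (2 * x ^+ 2).
  by rewrite ler_expR; apply: le_trans hx2; apply: ler_norm.
have hm : expR (- x) <= expR (2 * x ^+ 2).
  by rewrite ler_expR; apply: le_trans hx2; rewrite -normrN; apply: ler_norm.
lra.
Qed.

Lemma cosh_add_sub x y : cosh (x + y) + cosh (x - y) = 2 * cosh x * cosh y.
Proof. by rewrite /cosh !opprD opprK !expRD; field. Qed.

Lemma cosh_ge0 x : 0 <= cosh x.
Proof. by rewrite /cosh divr_ge0 // addr_ge0 ?expR_ge0. Qed.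

Lemma expR_norm_le_cosh x : expR `|x| <= 2 * cosh x.
Proof.
rewrite /cosh mulrCA mulfV // mulr1.
by case: (ger0P x) => _; rewrite ?lerDl ?lerDr expR_ge0.
Qed.

(** The method of conditional expectations: averaged over the two values of
    one sign, each [cosh] grows by a factor at most
    [expR (2 * (lam i * v i J) ^+ 2)], so one of the two values does not make the
    weighted sum larger than this average. *)
Lemma signs_potential (I : finType) (T : eqType) (s : seq T) (w lam x : I -> R)
    (v : I -> T -> R) : uniq s -> (forall i, 0 <= w i) ->
  exists c : T -> R, (forall J, c J = 1 \/ c J = -1) /\
    \sum_i w i * cosh (lam i * (x i + \sum_(J <- s) c J * v i J)) <=
    \sum_i w i * (cosh (lam i * x i) *
       expR (2 * lam i ^+ 2 * \sum_(J <- s) v i J ^+ 2)).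
Proof.
move=> us w0; elim: s x us => [|J0 s IH] x /=.
  move=> _; exists (fun=> 1); split; first by move=> _; left.
  by apply: ler_sum => i _; rewrite !big_nil addr0 mulr0 expR0 mulr1.
move=> /andP[Js us].
pose S (e : R) := \sum_i w i * (cosh (lam i * (x i + e * v i J0)) *
    expR (2 * lam i ^+ 2 * \sum_(J <- s) v i J ^+ 2)).
pose S0 := \sum_i w i * (cosh (lam i * x i) *
    expR (2 * lam i ^+ 2 * \sum_(J <- J0 :: s) v i J ^+ 2)).
have hS : S 1 + S (- 1) <= 2 * S0.
  rewrite /S /S0 -big_split mulr_sumr; apply: ler_sum => i _ /=.
rewrite -mulrDr [leRHS]mulrCA ler_wpM2l // -mulrDl mul1r mulN1r !mulrDr mulrN.
  rewrite cosh_add_sub big_cons mulrDr expRD [leRHS]mulrCA -mulrA [leRHS]mulrCA.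
  rewrite -[leLHS]mulrA ler_wpM2l //.
  rewrite ler_wpM2l ?cosh_ge0 // ler_wpM2r ?expR_ge0 //.
  by apply: le_trans (cosh_le_expR_sqr _) _; rewrite exprMn mulrA.
have [e [he hSe]] : exists e : R, (e = 1 \/ e = -1) /\ S e <= S0.
  have [h|h] := leP (S 1) S0; first by exists 1; split; [left|].
  exists (-1); split; first by right.
  by move: h hS; move: (S 1) (S (- 1)) S0 => a b d; lra.
have [c [hc hcS]] := IH (fun i => x i + e * v i J0) us.
exists (fun J => if J == J0 then e else c J); split.
  by move=> J; case: eqP.
apply: le_trans hSe; apply: le_trans hcS; apply: ler_sum => i _.
rewrite big_cons eqxx addrA.
rewrite (eq_big_seq (fun J => c J * v i J)) // => J hJ.
by case: eqP => // e0; rewrite -e0 hJ in Js.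
Qed.

(** The Chernoff bound for each test, with the parameter of the exponential
    that balances its cost against its energy. *)
Lemma signs_exist_real (I T : finType) (A : {set T}) (t : I -> R) (v : I -> T -> R) :
  (\sum_i expR (- t i) < 2^-1) ->
  exists c : T -> R, (forall J, c J = 1 \/ c J = -1) /\
    forall i, (\sum_(J in A) c J * v i J) ^+ 2 <= 8 * t i * \sum_(J in A) v i J ^+ 2.
Proof.
move=> ht; pose V i := \sum_(J in A) v i J ^+ 2.
have V0 i : 0 <= V i by apply: sumr_ge0 => J _; apply: sqr_ge0.
have t0 i : 0 < t i.
  rewrite -oppr_lt0 -expR_lt1; apply: le_lt_trans (_ : 2^-1 < 1); last by lra.
  apply: le_trans (ltW ht); rewrite (bigD1 i) //= lerDl sumr_ge0 //.
pose lam i := Num.sqrt (t i / (2 * V i)).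
have lamV i : 2 * lam i ^+ 2 * V i <= t i.
  rewrite sqr_sqrtr; last by rewrite divr_ge0 ?mulr_ge0 // ltW.
  have [->|hV] := eqVneq (V i) 0; first by rewrite mulr0 ltW.
  by rewrite le_eqVlt; apply/orP; left; apply/eqP; field.
have [c [hc hS]] := @signs_potential I T (enum A) (fun i => expR (- 2 * t i))
  lam (fun=> 0) v (enum_uniq _) (fun i => expR_ge0 _).
exists c; split=> // i; set X := \sum_(J in A) _; rewrite -/(V i).
have [hV|hV] := eqVneq (V i) 0.
  rewrite hV mulr0 /X big1 ?expr0n // => J JA.
  have /eqP := hV; rewrite psumr_eq0 => [|? _]; last exact: sqr_ge0.
  by move=> /allP /(_ J (mem_index_enum _)); rewrite JA sqrf_eq0 => /eqP ->; rewrite mulr0.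
have Vp : 0 < V i by rewrite lt_def hV V0.
have lp : 0 < lam i by rewrite sqrtr_gt0 divr_gt0 // mulr_gt0.
have hX : expR (- 2 * t i) * cosh (lam i * X) < 2^-1.
  apply: le_lt_trans ht; apply: le_trans (_ : _ <= \sum_i0 expR (- 2 * t i0) *
      cosh (lam i0 * (0 + \sum_(J <- enum A) c J * v i0 J))) _.
    rewrite (bigD1 i) //= add0r big_enum /= -/X lerDl sumr_ge0 // => j _.
    by rewrite mulr_ge0 ?expR_ge0 ?cosh_ge0.
  apply: le_trans hS _; apply: ler_sum => j _.
  rewrite mulr0 {1}/cosh oppr0 expR0 divff // mul1r -expRD ler_expR big_enum /=.
  by have := lamV j; rewrite /V; lra.
have hlX : `|lam i * X| < 2 * t i.
  rewrite -ltr_expR; apply: le_lt_trans (expR_norm_le_cosh _) _.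
  move: hX; rewrite mulNr expRN mulrC ltr_pdivrMr ?expR_gt0 //; lra.
rewrite normrM gtr0_norm // in hlX.
have : (lam i * `|X|) ^+ 2 <= (2 * t i) ^+ 2.
  by rewrite lerXn2r ?nnegrE ?mulr_ge0 // ltW.
rewrite exprMn real_normK ?num_real // sqr_sqrtr; last by rewrite divr_ge0 ?mulr_ge0 // ltW.
rewrite mulrAC ler_pdivrMr ?mulr_gt0 // => h.
rewrite -(ler_pM2l (t0 i)); apply: le_trans h _.
by rewrite le_eqVlt; apply/orP; left; apply/eqP; ring.
Qed.

(** Real and imaginary parts are separate real tests whose energies add up to
    the complex energy; this doubles the number of tests. *)
Lemma signs_exist (I T : finType) (A : {set T}) (t : I -> R) (v : I -> T -> R[i]) :
  (\sum_i expR (- t i) < 4^-1) ->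
  exists c : T -> R[i], (forall J, c J = 1 \/ c J = -1) /\
    forall i, normc (\sum_(J in A) c J * v i J) ^+ 2 <=
       8 * t i * \sum_(J in A) normc (v i J) ^+ 2.
Proof.
move=> ht.
have [|c [hc hX]] := @signs_exist_real (I * bool)%type T A (fun p => t p.1)
  (fun p J => if p.2 then Re (v p.1 J) else Im (v p.1 J)).
  rewrite -(pair_bigA _ (fun i (_ : bool) => expR (- t i))) /=.
  under eq_bigr do rewrite big_bool /=.
  by rewrite big_split /=; lra.
exists (fun J => (c J)%:C); split=> [J|i].
  by case: (hc J) => ->; [left | right; rewrite rmorphN].
rewrite normcE_sqr; have hr := hX (i, true); have hi := hX (i, false).
have -> : \sum_(J in A) normc (v i J) ^+ 2 =
   \sum_(J in A) Re (v i J) ^+ 2 + \sum_(J in A) Im (v i J) ^+ 2.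
  by rewrite -big_split; apply: eq_bigr => J _; rewrite normcE_sqr.
rewrite mulrDr lerD //.
  apply: le_trans hr; rewrite le_eqVlt; apply/orP; left; apply/eqP; congr (_ ^+ 2).
  elim/big_rec2: _ => //= J y1 y2 _ <-.
  by case: (v i J) y2 => a b [a' b'] /=; rewrite mul0r subr0.
apply: le_trans hi; rewrite le_eqVlt; apply/orP; left; apply/eqP; congr (_ ^+ 2).
elim/big_rec2: _ => //= J y1 y2 _ <-.
by case: (v i J) y2 => a b [a' b'] /=; rewrite mul0r addr0.
Qed.

End Signs.

(** * Elementary symmetric sums and Steiner systems *)

Section Combinatorics.
Variable R : realType.

Lemma sum_injective_le (I J : finType) (D : {set I}) (E : {set J}) (h : I -> J)
    (f : J -> R) : (forall j, 0 <= f j) -> {in D &, injective h} ->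
  (forall i, i \in D -> h i \in E) -> \sum_(i in D) f (h i) <= \sum_(j in E) f j.
Proof.
move=> f0 hinj hE; rewrite -(big_imset f hinj) /=.
rewrite [leRHS](bigID (mem (h @: D))) /=
  [X in _ <= X + _](eq_bigl (mem (h @: D))).
  by rewrite lerDl sumr_ge0.
move=> j; rewrite andb_idl // => /imsetP[i iD ->].
exact: hE.
Qed.

Variable n : nat.
Implicit Types (x : 'I_n -> R) (JJ : {set {set 'I_n}}).

(** With [s m] for the sum over the sets of size [m], induction on
    [m.+1 * s m.+1 <= s m * s 1]: a set of size [m.+1] with a marked element
    is a set of size [m] together with another element. *)
Lemma elementary_symmetric_le x m : (forall j, 0 <= x j) ->
  m`!%:R * \sum_(T : {set 'I_n} | #|T| == m) \prod_(j in T) x j <=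
  (\sum_j x j) ^+ m.
Proof.
move=> x0; have p0 (T : {set 'I_n}) : 0 <= \prod_(j in T) x j by apply: prodr_ge0.
elim: m => [|m IH].
  rewrite (big_pred1 finset.set0); last by move=> T; rewrite cards_eq0.
  by rewrite big_set0 fact0 mul1r expr0.
have step : m.+1%:R * \sum_(S : {set 'I_n} | #|S| == m.+1) \prod_(j in S) x j <=
    (\sum_(T : {set 'I_n} | #|T| == m) \prod_(j in T) x j) * \sum_j x j.
  rewrite mulr_sumr (eq_bigr (fun S : {set 'I_n} =>
    \sum_(j | j \in S) \prod_(i in S :\ j) x i * x j)); last first.
    move=> S /eqP hS; rewrite -hS mulr_natl -sumr_const; apply: eq_bigr => j jS.
    by rewrite (finset.big_setD1 j jS) mulrC.
  rewrite (exchange_big_dep xpredT) //= mulr_sumr; apply: ler_sum => j _.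
  rewrite -mulr_suml ler_wpM2r //.
  pose D := [set S : {set 'I_n} | (#|S| == m.+1) && (j \in S)].
  rewrite (eq_bigl (fun S => S \in D)); last by move=> S; rewrite inE.
  rewrite [leRHS](eq_bigl (fun T => T \in [set T : {set 'I_n} | #|T| == m])); last first.
    by move=> T; rewrite inE.
  apply: (sum_injective_le (h := fun S : {set 'I_n} => S :\ j)
    (f := fun T : {set 'I_n} => \prod_(i in T) x i)) => //.
    move=> S1 S2; rewrite !inE => /andP[_ h1] /andP[_ h2] e.
    by rewrite -(finset.setD1K h1) -(finset.setD1K h2) e.
  move=> S; rewrite !inE => /andP[/eqP hS jS].
  by move: hS; rewrite (cardsD1 j) jS add1n => -[->].
rewrite factS natrM mulrAC mulrC mulrA exprSr.
apply: le_trans (ler_wpM2r _ IH); last exact: sumr_ge0.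
by rewrite -!mulrA ler_wpM2l // mulrC.
Qed.

(** A set of size [k - 1] is obtained by deleting a point from at most one
    block.  This is how the Steiner condition enters the whole proof. *)
Lemma steiner_sum_le k JJ (f : {set 'I_n} -> R) : partial_steiner (k - 1) k JJ ->
  (forall T, 0 <= f T) ->
  \sum_(J in JJ) \sum_(j in J) f (J :\ j) <=
  \sum_(T : {set 'I_n} | #|T| == (k - 1)%N) f T.
Proof.
move=> [hk hT] f0.
apply: (@le_trans _ _ (\sum_(J in JJ)
    \sum_(T : {set 'I_n} | (#|T| == (k - 1)%N) && (T \subset J)) f T)).
  apply: ler_sum => J hJ.
  rewrite [leRHS](eq_bigl (fun T => T \in
    [set T : {set 'I_n} | (#|T| == (k - 1)%N) && (T \subset J)])); last first.
    by move=> T; rewrite inE.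
  apply: (sum_injective_le (h := fun j => J :\ j)) => //.
    move=> i j iJ jJ e; apply/eqP; apply: contraTT isT => ij.
    have : i \in J :\ j by rewrite !inE ij iJ.
    by rewrite -e !inE eqxx.
  move=> j jJ; rewrite inE subsetDl andbT.
  have := hk J hJ; rewrite (cardsD1 j) jJ => <-.
  by rewrite add1n subn1.
rewrite (exchange_big_dep (fun T : {set 'I_n} => #|T| == (k - 1)%N)) /=; last first.
  by move=> J T _ /andP[].
apply: ler_sum => T /eqP hcard.
have := hT T hcard; set D := [set J in JJ | _] => hD.
rewrite (eq_bigl (fun J => J \in D)); last by move=> J; rewrite !inE hcard eqxx.
by rewrite sumr_const -mulr_natl ler_piMl // lern1.
Qed.

Lemma steiner_weighted_le k JJ x : partial_steiner (k - 1) k JJ ->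
  (forall j, 0 <= x j) ->
  (k - 1)`!%:R * \sum_(J in JJ) \sum_(j in J) \prod_(i in J :\ j) x i <=
  (\sum_j x j) ^+ (k - 1).
Proof.
move=> hJ x0; apply: le_trans (elementary_symmetric_le _ x0).
rewrite ler_wpM2l //.
apply: (steiner_sum_le (f := fun T => \prod_(i in T) x i) hJ) => T.
exact: prodr_ge0.
Qed.

Lemma steiner_card_le k JJ : (0 < k)%N -> partial_steiner (k - 1) k JJ ->
  k`!%:R * #|JJ|%:R <= (n%:R : R) ^+ (k - 1).
Proof.
move=> k0 hJ; have := steiner_weighted_le (x := fun=> 1) hJ (fun=> ler01).
rewrite sumr_const card_ord; apply: le_trans.
rewrite (eq_bigr (fun=> k%:R)); last first.
  move=> J hJJ; rewrite (eq_bigr (fun=> 1)) => [|j _]; last by rewrite big1.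
  by rewrite sumr_const (hJ.1 _ hJJ).
rewrite sumr_const -[in k`!](prednK k0) factS prednK // subn1 natrM.
by rewrite -(mulr_natr k%:R #|JJ|) mulrCA mulrA.
Qed.

(** With [C = y^s], the left-hand side is [(y^k / k!)^s], and [y^k / k!] is a
    term of the series of [expR y]. *)
Lemma exp_growth_le_factorial (C s : R) (k : nat) : 0 < C -> 0 < s ->
  C ^+ k / (k`!%:R `^ s) <= expR (s * C `^ s^-1).
Proof.
move=> C0 s0; pose y := C `^ s^-1.
have y0 : 0 < y by apply: powR_gt0.
have f0 : 0 < (k`!%:R : R) by rewrite ltr0n fact_gt0.
have hy : y ^+ k / k`!%:R <= expR y.
  case: k f0 => [|k] f0; last first.
    by apply: le_trans (expR_ge1Dxn k (ltW y0)); rewrite lerDr.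
  by rewrite expr0 fact0 divr1 -[leLHS](@expR0 R) ler_expR ltW.
rewrite -/y; have -> : C = y `^ s by rewrite -powRrM mulVf ?gt_eqF // powRr1 // ltW.
rewrite -powR_mulrn ?powR_ge0 // powRAC powR_mulrn ?(ltW y0) //.
have -> : (y ^+ k) `^ s / (k`!%:R `^ s) = (y ^+ k / k`!%:R) `^ s.
  rewrite powRM ?exprn_ge0 ?invr_ge0 ?(ltW y0) //.
  by rewrite -[_^-1 in RHS]powR_inv1 // powRAC powR_inv1 ?powR_ge0.
have -> : expR (s * y) = expR y `^ s by rewrite /powR gt_eqF ?expR_gt0 // expRK.
by rewrite ge0_ler_powR ?nnegrE ?expR_ge0 ?divr_ge0 ?exprn_ge0 ?(ltW y0) ?(ltW s0).
Qed.

End Combinatorics.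

(** * Scales and the family of tests *)

(** Scales [4^-m] with [m < levels n]: the last one is below [1 / n], so
    coordinates may be rounded up to it at bounded total cost, and there are
    only [O(log n)] of them. *)
Definition levels (n : nat) : nat := (trunc_log 2 n).+2.

Section Numerics.
Variable R : realType.

Lemma expR_half_le2 : expR (2^-1 : R) <= 2.
Proof.
have := expR_ge1Dx (- 2^-1 : R); rewrite expRN => h.
rewrite -[leRHS]invrK -[leLHS]invrK lef_pV2 ?posrE ?invr_gt0 ?expR_gt0 //.
by apply: le_trans h; lra.
Qed.

Lemma expR1_le4 : expR (1 : R) <= 4.
Proof.
have -> : expR (1 : R) = expR 2^-1 * expR 2^-1.
  by rewrite -expRD; congr expR; field.
have h := expR_half_le2; have := expR_ge0 (2^-1 : R); nra.
Qed.

Lemma ln2_ge_half : 2^-1 <= ln (2 : R).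
Proof. by rewrite -[leLHS]expRK ler_ln ?posrE ?expR_gt0 ?expR_half_le2. Qed.

Lemma ln_ge_half n : (3 <= n)%N -> 2^-1 <= ln (n%:R : R).
Proof.
move=> hn; apply: le_trans ln2_ge_half _.
by rewrite ler_ln ?posrE ?ltr0n ?ler_nat //; lia.
Qed.

Lemma levels_le n : (3 <= n)%N -> (levels n <= n.+1)%N.
Proof.
move=> hn; rewrite /levels ltnS; apply: leq_trans (ltn_expl _ (isT : (1 < 2)%N)) _.
by apply: trunc_logP => //; lia.
Qed.

Lemma levels_resolve n : (3 <= n)%N -> (n <= 4 ^ (levels n).-1)%N.
Proof.
move=> hn; rewrite /levels /=; apply: leq_trans (ltnW (trunc_log_ltn n (isT : (1 < 2)%N))) _.
by rewrite leq_exp2r.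
Qed.

Lemma levels_le_ln n : (3 <= n)%N -> (levels n)%:R <= 6 * ln (n%:R : R).
Proof.
move=> hn; have h1 := ln_ge_half hn; have h2 := ln2_ge_half.
have : (trunc_log 2 n)%:R * ln (2 : R) <= ln (n%:R : R).
  rewrite mulr_natl -lnXn // -natrX ler_ln ?posrE ?ltr0n ?expn_gt0 ?(ltnW (ltnW hn)) //.
  by rewrite ler_nat trunc_logP // (ltnW (ltnW hn)).
have : (trunc_log 2 n)%:R * 2^-1 <= (trunc_log 2 n)%:R * ln (2 : R) by rewrite ler_wpM2l.
rewrite /levels -(addn2 (trunc_log 2 n)) (natrD _ (trunc_log 2 n) 2); lra.
Qed.

End Numerics.

Section Tests.
Variables (R : realType) (n : nat).
Local Notation L := (levels n).
Local Notation config := {ffun 'I_n -> option ('I_L * 'I_4)}.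

(** A test is either a point of the torus with fourth roots of unity as
    coordinates, or a level with a sparse point: each coordinate of a
    configuration is zero or has a scale and a phase. *)
Definition tests : finType := ({ffun 'I_n -> 'I_4} + 'I_L * config)%type.

Definition support_size (g : config) : R := \sum_j (isSome (g j))%:R.

(** The costs are logarithms of prior weights: [n^-4] for the level, and a
    further [n^-4] for each nonzero coordinate, so that the weights sum to a
    product over the coordinates. *)
Definition test_cost (i : tests) : R :=
  match i with
  | inl _ => 4 * n%:R
  | inr p => 4 * ln n%:R * (1 + support_size p.2)
  end.

Lemma test_cost_sum : (3 <= n)%N -> \sum_i expR (- test_cost i) < 4^-1.
Proof.
move=> hn; have n0 : 0 < n%:R :> R by rewrite ltr0n; lia.
have hn3 : 3 <= n%:R :> R by rewrite (ler_nat R 3).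
rewrite big_sumType /=.
(* The torus tests weigh [(4 / e^4)^n] in total. *)
have torus : \sum_(w : {ffun 'I_n -> 'I_4}) expR (- (4 * n%:R) : R) <= 64^-1.
  rewrite sumr_const card_ffun !card_ord -[_ *+ (4 ^ n)]mulr_natl natrX.
  have -> : - (4 * n%:R) = n%:R * (- 4) :> R by ring.
  rewrite expRM_natl -exprMn.
  have h0 : 0 <= 4 * expR (- 4 : R) by rewrite mulr_ge0 ?expR_ge0.
  have h1 : 4 * expR (- 4 : R) <= 4^-1.
    rewrite expRN ler_pdivrMr ?expR_gt0 //.
    have e4 : expR (4 : R) = expR 1 ^+ 4 by rewrite -expRM_natl mulr1.
    have e1 : 2 <= expR (1 : R) by have := expR_ge1Dx (1 : R); lra.
    rewrite e4; apply: le_trans (_ : 4^-1 * 2 ^+ 4 <= _); first by lra.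
    by rewrite ler_wpM2l // lerXn2r ?nnegrE // expR_ge0.
  apply: le_trans (_ : (4^-1) ^+ n <= _); first by rewrite lerXn2r ?nnegrE.
  apply: le_trans (ler_wiXn2l _ _ hn) _ => //; first by lra.
  lra.
(* For each level, the sum over configurations factors as
   [(1 + 4 L / n^4)^n <= e], because each coordinate has [4 L] nonzero values. *)
have chain : \sum_(p : 'I_L * config) expR (- test_cost (inr p)) <= 5^-1.
  pose q := expR (- (4 * ln (n%:R : R))).
  have q0 : 0 <= q by apply: expR_ge0.
  have hq : q = (n%:R ^+ 4)^-1 by rewrite /q expRN expRM_natl lnK.
  rewrite -(pair_bigA _ (fun (_ : 'I_L) (g : config) =>
    expR (- (4 * ln n%:R * (1 + support_size g))))) /=.
  rewrite sumr_const card_ord.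
  rewrite (eq_bigr (fun g : config => q * \prod_j (if isSome (g j) then q else 1))); last first.
    move=> g _; rewrite mulrDr mulr1 opprD expRD; congr (_ * _).
    rewrite /support_size mulr_sumr -sumrN expR_sum; apply: eq_bigr => j _.
    by case: (g j) => [?|] /=; rewrite ?mulr1 ?mulr0 ?oppr0 ?expR0.
  rewrite -mulr_sumr -(bigA_distr_bigA (fun _ (o : option ('I_L * 'I_4)) =>
    if isSome o then q else 1)) /=.
  rewrite prodr_const card_ord (bigD1 None) //=.
  rewrite (eq_bigr (fun=> q)); last by case.
  rewrite sumr_const cardC1 card_option card_prod !card_ord /=.
  have LN : L%:R <= n%:R + 1 :> R by rewrite natr1 ler_nat levels_le.
  have L4 : (L * 4)%:R <= 4 * (n%:R + 1) :> R by rewrite natrM; lra.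
  have q4 : 0 <= q *+ (L * 4) by rewrite mulrn_wge0.
  move: L4 q4; set M := (L * 4)%N => M4 q4.
  have n2 : 9 <= n%:R ^+ 2 :> R by nra.
  have n4 : n%:R ^+ 4 = n%:R ^+ 2 * n%:R ^+ 2 :> R by rewrite -exprD.
  have n4p : 0 < n%:R ^+ 4 :> R by rewrite exprn_gt0.
  have hsup : (1 + q *+ M) ^+ n <= 4.
    apply: (@le_trans _ _ (expR (n%:R^-1) ^+ n)); last first.
      by rewrite -expRM_natl mulfV ?gt_eqF // expR1_le4.
    have q5 : 0 <= 1 + q *+ M by rewrite addr_ge0.
    rewrite lerXn2r ?nnegrE ?expR_ge0 //.
    apply: le_trans (expR_ge1Dx _); rewrite lerD2l -(mulr_natl q) hq.
    rewrite ler_pdivrMr // ler_pdivlMl //.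
    by rewrite n4; nra.
  have hL : q * L%:R <= 20^-1.
    by rewrite hq mulrC ler_pdivrMr //; nra.
  rewrite -[_ *+ L]mulr_natr mulrAC.
  have : 0 <= L%:R :> R by [].
  have : 0 <= (1 + q *+ M) ^+ n by rewrite exprn_ge0 // addr_ge0.
  have : 0 <= q * L%:R by rewrite mulr_ge0.
  move: hsup hL; set u := (1 + _) ^+ n; set v := q * _; nra.
rewrite /=; lra.
Qed.
End Tests.

(** * Signs that are good on the torus and on the Euclidean ball *)

Section Chaining.
Variables (R : realType) (n k : nat) (JJ : {set {set 'I_n}}).
Variable a : {set 'I_n} -> R[i].
Hypotheses (k3 : (3 <= k)%N) (kn : (k <= n)%N).
Hypothesis steiner : partial_steiner (k - 1) k JJ.
Hypothesis a_le1 : forall J, J \in JJ -> normc (a J) <= 1.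
Local Notation L := (levels n).
Local Notation config := {ffun 'I_n -> option ('I_L * 'I_4)}.

Definition config_value (o : option ('I_L * 'I_4)) : R[i] :=
  if o is Some (m, w) then (2^-1 ^+ m)%:C * 'i ^+ w else 0.

Definition at_level (l : 'I_L) (o : option ('I_L * 'I_4)) : bool :=
  if o is Some (m, _) then m == l else false.

Definition config_point (g : config) : 'rV[R[i]]_n := \row_j config_value (g j).

(** The sparse test [(l, g)] keeps the blocks that meet the level [l] of the
    configuration [g]. *)
Definition test_vector (i : tests n) (J : {set 'I_n}) : R[i] :=
  match i with
  | inl w => a J * monomial J (phase_point (fun=> 1) w)
  | inr p => if [exists j in J, at_level p.1 (p.2 j)]
             then a J * monomial J (config_point p.2) else 0
  end.

Lemma normc_phase (r : R) m : 0 <= r -> normc (r%:C * 'i ^+ m) = r.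
Proof. by move=> r0; rewrite normcM normcX normc_i expr1n mulr1 normc_real ger0_norm. Qed.

Lemma torus_energy w : \sum_(J in JJ) normc (test_vector (inl w) J) ^+ 2 <= #|JJ|%:R.
Proof.
rewrite -sumr_const; apply: ler_sum => J hJ /=.
rewrite normcM normc_monomial big1 ?mulr1 ?expr_le1 ?normc_ge0 ?a_le1 //.
by move=> j _; rewrite mxE normc_phase.
Qed.

(** In each block delete a point of level [l]: it contributes [4^-l] to the
    squared monomial, and the remaining sets of size [k - 1] are distinct. *)
Lemma level_energy (l : 'I_L) (g : config) :
  \sum_j normc (config_value (g j)) ^+ 2 <= 5 ->
  \sum_(J in JJ) normc (test_vector (inr (l, g)) J) ^+ 2 <= 4^-1 ^+ l * 5 ^+ (k - 1).
Proof.
pose y j := normc (config_value (g j)) ^+ 2; move=> hy.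
have y0 j : 0 <= y j by apply: sqr_ge0.
apply: (@le_trans _ _ (4^-1 ^+ l *
    \sum_(J in JJ) \sum_(j in J) \prod_(i in J :\ j) y i)); last first.
  rewrite ler_wpM2l ?exprn_ge0 ?invr_ge0 //.
  apply: (@le_trans _ _ ((\sum_j y j) ^+ (k - 1))); last first.
    by rewrite lerXn2r ?nnegrE ?sumr_ge0.
  apply: le_trans (steiner_weighted_le steiner y0); rewrite ler_peMl //.
    by apply: sumr_ge0 => J _; apply: sumr_ge0 => j _; apply: prodr_ge0.
  by rewrite ler1n fact_gt0.
rewrite mulr_sumr; apply: ler_sum => J hJ /=.
have p0 (j : 'I_n) : 0 <= \prod_(i in J :\ j) y i by apply: prodr_ge0.
case: existsP => [[j /andP[jJ hj]]|_]; last first.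
  by rewrite normc0 expr0n mulr_ge0 ?exprn_ge0 ?invr_ge0 // sumr_ge0.
apply: (@le_trans _ _ (4^-1 ^+ l * \prod_(i in J :\ j) y i)); last first.
  rewrite ler_wpM2l ?exprn_ge0 ?invr_ge0 // (bigD1 j jJ) /= lerDl.
  by rewrite sumr_ge0.
have -> : 4^-1 ^+ l = y j.
  rewrite /y; case: (g j) hj => [[m w]|//] /= /eqP ->.
  rewrite normc_phase ?exprn_ge0 ?invr_ge0 // -exprM mulnC exprM; congr (_ ^+ _).
  by field.
rewrite -finset.big_setD1 // normcM exprMn normc_monomial -prodrXl.
rewrite (eq_bigr y) => [|i _]; last by rewrite mxE.
by rewrite ler_piMl ?prodr_ge0 // expr_le1 ?normc_ge0 ?a_le1.
Qed.

Definition truncated (e : 'I_n -> 'I_L) (w : {ffun 'I_n -> 'I_4})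
    (l : 'I_L) : config :=
  [ffun j => if (e j <= l)%N then Some (e j, w j) else None].

(** The level of the coordinate of smallest modulus in the block. *)
Definition top_level (e : 'I_n -> 'I_L) (J : {set 'I_n}) : nat :=
  \max_(j in J) (e j : nat).

(** Coordinates beyond the level [l] are set to zero, which kills the blocks
    reaching further, and the blocks that stay strictly above are discarded by
    the test. *)
Lemma test_vector_truncated e w l J : J \in JJ ->
  test_vector (inr (l, truncated e w l)) J =
  if top_level e J == l
  then a J * monomial J (phase_point (fun j => 2^-1 ^+ e j) w) else 0.
Proof.
move=> hJ /=; have J0 : (0 < #|J|)%N by rewrite (steiner.1 _ hJ) (leq_trans _ k3).
case: existsP => [[j /andP[jJ]]|hno].
  rewrite ffunE; case: leqP => //= ejl /eqP el.
  have [hle|hlt] := leqP (top_level e J) l.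
    have below i : i \in J -> (e i <= l)%N.
      by move=> iJ; apply: leq_trans hle; apply: (leq_bigmax_cond i iJ).
    have -> : top_level e J = l.
      by apply/eqP; rewrite eqn_leq hle -el /top_level (leq_bigmax_cond j).
    rewrite eqxx; congr (_ * _); apply: eq_bigr => i iJ.
    by rewrite !mxE ffunE below.
  rewrite (gtn_eqF hlt); have [i iJ hi] := eq_bigmax_cond (fun j => e j : nat) J0.
  rewrite /monomial (bigD1 i) //= mxE ffunE leqNgt -hi.
  by rewrite -[X in (l < X)%N]/(top_level e J) hlt /= mul0r mulr0.
case: eqP => // hl; case: hno.
have [j jJ hj] := eq_bigmax_cond (fun j => e j : nat) J0.
exists j; rewrite jJ ffunE /=.
have ejl : e j = l by apply/val_inj; rewrite /= -hl /top_level hj.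
by rewrite ejl leqnn /= eqxx.
Qed.

Lemma truncated_energy (e : 'I_n -> 'I_L) w l : \sum_j 4^-1 ^+ e j <= 5 :> R ->
  \sum_j normc (config_value (truncated e w l j)) ^+ 2 <= 5.
Proof.
apply: le_trans; apply: ler_sum => j _; rewrite ffunE; case: leqP => _.
  rewrite normc_phase ?exprn_ge0 ?invr_ge0 // -exprM mulnC exprM.
  by rewrite (_ : 2^-1 ^+ 2 = 4^-1 :> R) //; field.
by rewrite [config_value _]/(0 : R[i]) normc0 expr0n exprn_ge0 ?invr_ge0.
Qed.

(** Each nonzero coordinate takes at least [4^-l] of the available total [5].
    The growth of the cost with [l] thus compensates the decay in
    [level_energy]. *)
Lemma truncated_support (e : 'I_n -> 'I_L) w (l : 'I_L) : \sum_j 4^-1 ^+ e j <= 5 :> R ->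
  4^-1 ^+ l * (1 + support_size R (truncated e w l)) <= 6.
Proof.
move=> h5; rewrite mulrDr mulr1 (_ : 6 = 1 + 5); last by ring.
apply: lerD; first by apply: exprn_ile1; lra.
apply: le_trans h5; rewrite mulr_sumr; apply: ler_sum => j _; rewrite ffunE.
case: leqP => [h|_] /=; last by rewrite mulr0 exprn_ge0 ?invr_ge0.
by rewrite mulr1; apply: ler_wiXn2l => //; lra.
Qed.

Lemma multiform_top_levels (b : {set 'I_n} -> R[i]) (e : 'I_n -> 'I_L) z :
  multiform JJ b z =
  \sum_(l < L) multiform [set J in JJ | top_level e J == l] b z.
Proof.
rewrite /multiform (partition_big (fun J => inord (top_level e J) : 'I_L) xpredT) //=.
apply: eq_bigr => l _; apply: eq_bigl => J; rewrite inE; congr (_ && _).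
rewrite -val_eqE /= inordK // /top_level.
by apply/bigmax_leqP => j _; rewrite -ltnS.
Qed.

(** On the torus the cost is [O(n)] and the energy [#|JJ| <= n^(k-1) / k!].  On
    the Euclidean ball each of the [O(log n)] levels contributes
    [O(sqrt (log n))] up to a factor [C^k]; the sum over the levels produces the
    exponent [3 / 2]. *)
Lemma good_signs : exists c : {set 'I_n} -> R[i],
  [/\ forall J, c J = 1 \/ c J = -1,
      forall z : 'rV[R[i]]_n, (forall j, normc (z 0 j) <= 1) ->
        normc (multiform JJ (fun J => c J * a J) z) <=
          36 ^+ k * Num.sqrt (n%:R ^+ k / k`!%:R)
    & forall e : 'I_n -> 'I_L, \sum_j 4^-1 ^+ e j <= 5 :> R ->
      forall z : 'rV[R[i]]_n, (forall j, normc (z 0 j) <= 2^-1 ^+ e j) ->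
        normc (multiform JJ (fun J => c J * a J) z) <=
          36 ^+ k * (ln n%:R * Num.sqrt (ln n%:R))].
Proof.
have n3 : (3 <= n)%N := leq_trans k3 kn.
have hk : k_uniform k JJ by apply: steiner.1.
have [c [hc hX]] := signs_exist JJ test_vector (test_cost_sum R n3).
exists c; split=> // [|e he] z hz.
  have hphase w : normc (multiform JJ (fun J => c J * a J) (phase_point (fun=> 1) w))
      <= 6 * Num.sqrt (n%:R ^+ k / k`!%:R).
    rewrite -(ler_pXn2r (n := 2)) ?nnegrE ?normc_ge0 ?mulr_ge0 ?sqrtr_ge0 //.
    rewrite exprMn sqr_sqrtr ?divr_ge0 ?exprn_ge0 //.
    have := hX (inl w); rewrite (eq_bigr (fun J =>
        c J * a J * monomial J (phase_point (fun=> 1) w))); last first.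
      by move=> J _; rewrite mulrA.
    move=> /le_trans; apply.
    apply: le_trans (ler_wpM2l _ (torus_energy w)) _.
      by rewrite /= !mulr_ge0.
    rewrite [leRHS]mulrA ler_pdivlMr ?ltr0n ?fact_gt0 //=.
    have := steiner_card_le R (leq_trans (ltn0Sn 2) k3) steiner.
    have -> : n%:R ^+ k = n%:R * n%:R ^+ (k - 1) :> R.
      by rewrite -exprS subn1 prednK // (leq_trans _ k3).
    have : 0 <= n%:R :> R by [].
    set u := n%:R; set f := k`!%:R; set j := #|JJ|%:R; set v := u ^+ _.
    move=> u0 hfj; have : 0 <= f * j by rewrite mulr_ge0.
    nra.
  apply: le_trans (polydisc_bound_of_phases hk (fun=> ler01) hphase hz) _.
  rewrite mulrA ler_wpM2r ?sqrtr_ge0 //.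
  have -> : (36 : R) = 2 * 18 by ring.
  rewrite exprMn ler_wpM2l ?exprn_ge0 //.
  apply: le_trans (ler_weXn2l _ k3); lra.
have hln := ln_ge_half R n3.
have ln0 : 0 <= ln (n%:R : R) by lra.
have k0 : (0 < k)%N := leq_trans (ltn0Sn 2) k3.
set b := fun J => c J * a J.
have hlevel (l : 'I_L) : normc (multiform [set J in JJ | top_level e J == l] b z)
    <= 2 ^+ k * (14 * 3 ^+ k * Num.sqrt (ln n%:R)).
  apply: (@polydisc_bound_of_phases _ _ _ _ _ (fun j => 2^-1 ^+ e j)) hz => //.
    by move=> J; rewrite inE => /andP[/hk].
  move=> w.
  rewrite -(ler_pXn2r (n := 2)) ?nnegrE ?normc_ge0 ?mulr_ge0 ?exprn_ge0 ?sqrtr_ge0 //.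
  have := hX (inr (l, truncated e w l)).
  rewrite (eq_bigr (fun J => if top_level e J == l then
      b J * monomial J (phase_point (fun j => 2^-1 ^+ e j) w) else 0)); last first.
    by move=> J hJ; rewrite test_vector_truncated //; case: ifP => _; rewrite ?mulr0 ?mulrA.
  rewrite -big_mkcondr (eq_bigl (fun J =>
      J \in [set J in JJ | top_level e J == l])); last first.
    by move=> J; rewrite inE.
  move=> /le_trans; apply.
  have -> : test_cost R (inr (l, truncated e w l)) =
    4 * ln n%:R * (1 + support_size R (truncated e w l)) by [].
  set s := support_size R _.
  have s0 : 0 <= s by apply: sumr_ge0.
  apply: le_trans (ler_wpM2l _ (level_energy l (truncated_energy w l he))) _.
    by rewrite !mulr_ge0 ?addr_ge0.
  rewrite !exprMn sqr_sqrtr // -[3 ^+ k ^+ 2]exprM mulnC exprM.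
  have h1 := truncated_support w l he; rewrite -/s in h1.
  have h2 : 5 ^+ (k - 1) <= (3 ^+ 2) ^+ k :> R.
    apply: (@le_trans _ _ (5 ^+ k)); first by apply: ler_weXn2l; [lra | lia].
    by rewrite lerXn2r ?nnegrE //; lra.
  have h5 : 0 <= 5 ^+ (k - 1) :> R by rewrite exprn_ge0.
  apply: (@le_trans _ _ (192 * ln n%:R * 5 ^+ (k - 1))).
    have -> : 8 * (4 * ln n%:R * (1 + s)) * (4^-1 ^+ l * 5 ^+ (k - 1)) =
       (32 * ln n%:R * 5 ^+ (k - 1)) * (4^-1 ^+ l * (1 + s)) by ring.
    have -> : 192 * ln n%:R * 5 ^+ (k - 1) = (32 * ln n%:R * 5 ^+ (k - 1)) * 6 :> R by ring.
    by rewrite ler_wpM2l // !mulr_ge0.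
  rewrite [leRHS]mulrAC; apply: ler_pM => //; first by rewrite mulr_ge0.
  by rewrite ler_wpM2r //; lra.
rewrite (multiform_top_levels _ e); apply: le_trans (normc_sum_le _ _ _) _.
apply: le_trans (ler_sum _ (fun l _ => hlevel l)) _.
rewrite sumr_const card_ord -[_ *+ L]mulr_natl.
have -> : L%:R * (2 ^+ k * (14 * 3 ^+ k * Num.sqrt (ln n%:R))) =
   14 * L%:R * 6 ^+ k * Num.sqrt (ln n%:R) :> R.
  by rewrite (_ : 6 = 2 * 3); [rewrite exprMn; ring | ring].
rewrite [leRHS]mulrA ler_wpM2r ?sqrtr_ge0 //.
apply: (@le_trans _ _ (14 * (6 * ln n%:R) * 6 ^+ k)).
  by rewrite ler_wpM2r ?exprn_ge0 // ler_wpM2l // levels_le_ln.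
have -> : 36 ^+ k = 6 ^+ k * 6 ^+ k :> R by rewrite -exprMn; congr (_ ^+ _); ring.
have -> : 14 * (6 * ln n%:R) * 6 ^+ k = 84 * 6 ^+ k * ln n%:R :> R by ring.
rewrite ler_wpM2r // ler_wpM2r ?exprn_ge0 //.
apply: le_trans (ler_weXn2l _ k3); lra.
Qed.
End Chaining.

(** * Interpolation between the balls *)

Section Assembly.
Variable R : realType.

(** The exponent [e j] is the largest one for which [4^-(e j)] dominates
    [`|z j|^q].  Either the next one fails, so that [4^-(e j) <= 4 `|z j|^q], or
    the last scale is reached and [4^-(e j) <= 1 / n]. *)
Lemma dyadic_rounding n (q : R) (z : 'rV[R[i]]_n) : (3 <= n)%N -> 0 < q ->
  lq_norm q z <= 1 ->
  exists e : 'I_n -> 'I_(levels n), \sum_j 4^-1 ^+ e j <= 5 :> R /\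
    forall j, normc (z 0 j) <= (4 `^ (- q^-1)) ^+ e j.
Proof.
move=> n3 q0 hz; pose x j := normc (z 0 j) `^ q.
have x0 j : 0 <= x j by apply: powR_ge0.
have S0 : 0 <= \sum_j x j by apply: sumr_ge0.
have x1 : \sum_j x j <= 1.
  have : lq_norm q z `^ q <= 1 `^ q.
    by rewrite ge0_ler_powR ?nnegrE ?powR_ge0 // ltW.
  by rewrite powR1 /lq_norm -powRrM mulVf ?gt_eqF // powRr1.
have n0 : 0 < n%:R :> R by rewrite ltr0n; lia.
have four0 m : 0 < 4^-1 ^+ m :> R by rewrite exprn_gt0 ?invr_gt0.
have pick j : exists m : 'I_(levels n),
    x j <= 4^-1 ^+ m /\ 4^-1 ^+ m <= 4 * x j + n%:R^-1.
  pose P m := (m < levels n)%N && (x j <= 4^-1 ^+ m).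
  have P0 : P 0%N.
    rewrite /P expr0 /=; apply: le_trans x1.
    by rewrite (bigD1 j) //= lerDl sumr_ge0.
  have Pb m : P m -> (m <= levels n)%N by case/andP => /ltnW.
  have [m /andP[hm xm] mmax] := ex_maxnP (ex_intro P 0%N P0) Pb.
  exists (Ordinal hm); split=> //=.
  have [hlast|hnot] := leqP (levels n) m.+1.
    have -> : m = (levels n).-1 by rewrite -(eqP (_ : m.+1 == levels n)) // eqn_leq hm.
    apply: le_trans (_ : n%:R^-1 <= _); last by rewrite lerDr mulr_ge0.
    rewrite exprVn lef_pV2 ?posrE ?exprn_gt0 // -natrX ler_nat.
    exact: levels_resolve.
  have : ~~ P m.+1 by apply/negP => /mmax; rewrite ltnn.
  rewrite /P hnot /= -ltNge exprS => h.
  have : 0 <= n%:R^-1 :> R by rewrite invr_ge0.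
  by move: h; set y := _ ^+ m; lra.
have [e he] := fin_all_exists pick.
exists e; split.
  apply: le_trans (ler_sum _ (fun j _ => (he j).2)) _.
  rewrite big_split /= -mulr_sumr sumr_const card_ord -[_ *+ n]mulr_natr mulVf ?gt_eqF //.
  lra.
move=> j; have [hx _] := he j.
have -> : normc (z 0 j) = x j `^ q^-1.
  by rewrite /x -powRrM mulfV ?gt_eqF // powRr1 ?normc_ge0.
have -> : (4 `^ (- q^-1)) ^+ e j = (4^-1 ^+ e j) `^ q^-1.
  rewrite -[in RHS]powR_mulrn ?invr_ge0 // powRAC powR_mulrn ?powR_ge0 //.
  by congr (_ ^+ _); rewrite -(powR_inv1 (ler0n R 4)) -powRrM mulN1r.
rewrite ge0_ler_powR ?nnegrE ?invr_ge0 ?(ltW q0) ?x0 //.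
Qed.

Lemma multiform_l1_bound n k (JJ : {set {set 'I_n}}) (b : {set 'I_n} -> R[i])
    (x : 'I_n -> R) (s : R) (z : 'rV[R[i]]_n) :
  k_uniform k JJ -> (forall J, J \in JJ -> normc (b J) <= 1) ->
  (forall j, 0 <= x j) -> \sum_j x j <= s -> (forall j, normc (z 0 j) <= x j) ->
  normc (multiform JJ b z) <= s ^+ k / k`!%:R.
Proof.
move=> hk hb x0 hx hz; rewrite ler_pdivlMr ?ltr0n ?fact_gt0 // mulrC.
apply: (@le_trans _ _ ((\sum_j x j) ^+ k)); last first.
  by rewrite lerXn2r ?nnegrE ?(le_trans _ hx) ?sumr_ge0.
apply: le_trans (elementary_symmetric_le _ x0); rewrite ler_wpM2l //.
apply: le_trans (normc_sum_le _ _ _) _.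
apply: (@le_trans _ _ (\sum_(J in JJ) \prod_(j in J) x j)).
  apply: ler_sum => J hJ; rewrite normcM normc_monomial.
  apply: (@le_trans _ _ (1 * \prod_(j in J) x j)); last by rewrite mul1r.
  apply: ler_pM; rewrite ?normc_ge0 ?hb //.
    by apply: prodr_ge0 => j _; apply: normc_ge0.
  by apply: ler_prod => j _; rewrite normc_ge0 hz.
rewrite [leRHS](bigID (fun T => T \in JJ)) /= [X in _ <= X + _](eq_bigl (mem JJ)).
  by rewrite lerDl sumr_ge0 // => T _; apply: prodr_ge0.
by move=> T; rewrite /=; case: (boolP (T \in JJ)) => [/hk ->|]; rewrite ?eqxx ?andbF.
Qed.

(** The base [36] bounds the losses [C^k].  For [1 < q] and [q <> 2] the
    exponential is the bound of [exp_growth_le_factorial] for the power of [k!]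
    that survives interpolation, which makes the constant independent of [k].
    For [q = 1] the bound [5^k / k!] suffices directly. *)
Definition lq_const (k : nat) (q : R) : R :=
  if q == 2 then 36 ^+ k
  else if 2 < q then
    let s := (1 - 2 / q) / 2 in three_circles_const (2 / q) * expR (s * 36 `^ s^-1)
  else if 1 < q then
    let th := 2 / q - 1 in three_circles_const th * expR (th * 36 `^ th^-1)
  else expR 5.

Lemma three_circles_const_gt0 (th : R) : 0 < th < 1 -> 0 < three_circles_const th.
Proof.
move=> /andP[h0 h1]; rewrite /three_circles_const addr_gt0 // invr_gt0 subr_gt0.
  exact: two_powR_lt1.
by rewrite -opprB; apply: two_powR_lt1; rewrite subr_gt0.
Qed.

Lemma lq_const_gt0 k q : 0 < lq_const k q.
Proof.
rewrite /lq_const; case: eqP => [_|/eqP q2]; first by rewrite exprn_gt0.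
case: (ltP 2 q) => h2 /=.
  rewrite mulr_gt0 ?expR_gt0 // three_circles_const_gt0 //.
  have q0 : 0 < q by apply: lt_trans h2.
  by rewrite divr_gt0 //= ltr_pdivrMr // mul1r.
case: (ltP 1 q) => h1 /=; last exact: expR_gt0.
rewrite mulr_gt0 ?expR_gt0 // three_circles_const_gt0 //.
have q0 : 0 < q by apply: lt_trans h1.
have q2' : q < 2 by rewrite lt_neqAle q2.
by rewrite subr_gt0 ltr_pdivlMr // mul1r q2' /= ltrBlDr ltr_pdivrMr //; lra.
Qed.

Lemma four_powR (x : R) : 4 `^ x = 2 `^ (2 * x).
Proof. by rewrite powRrM powR_mulrn // (_ : 2 ^+ 2 = 4 :> R) //; ring. Qed.

Section Normalized.
Variables (n k : nat) (JJ : {set {set 'I_n}}) (b : {set 'I_n} -> R[i]).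
Hypotheses (k3 : (3 <= k)%N) (kn : (k <= n)%N) (hk : k_uniform k JJ).
Hypothesis hb : forall J, J \in JJ -> normc (b J) <= 1.
Hypothesis torus_bound : forall z : 'rV[R[i]]_n, (forall j, normc (z 0 j) <= 1) ->
  normc (multiform JJ b z) <= 36 ^+ k * Num.sqrt (n%:R ^+ k / k`!%:R).
Hypothesis l2_bound : forall e : 'I_n -> 'I_(levels n), \sum_j 4^-1 ^+ e j <= 5 :> R ->
  forall z : 'rV[R[i]]_n, (forall j, normc (z 0 j) <= 2^-1 ^+ e j) ->
  normc (multiform JJ b z) <= 36 ^+ k * (ln n%:R * Num.sqrt (ln n%:R)).

Let n3 : (3 <= n)%N := leq_trans k3 kn.

Let lnp : 0 < ln (n%:R : R).
Proof. by apply: lt_le_trans (ln_ge_half R n3); rewrite invr_gt0. Qed.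

Lemma l1_bound (e : 'I_n -> 'I_(levels n)) : \sum_j 4^-1 ^+ e j <= 5 :> R ->
  forall z : 'rV[R[i]]_n, (forall j, normc (z 0 j) <= 4^-1 ^+ e j) ->
  normc (multiform JJ b z) <= 5 ^+ k / k`!%:R.
Proof.
by move=> he z; apply: (multiform_l1_bound hk hb).
Qed.

Lemma ln_three_halves (x : R) : 0 <= x -> x * Num.sqrt x = x `^ (3 / 2).
Proof.
move=> x0; have -> : (3 : R) / 2 = 1 + 2^-1 by field.
rewrite powRD; last by rewrite gt_eqF //; lra.
by rewrite powRr1 // powR12_sqrt.
Qed.

(** Interpolation between the torus and the [l_2] ball, with [th = 2 / q]. *)
Lemma lq_bound_gt2 (q : R) z : 2 < q -> lq_norm q z <= 1 ->
  normc (multiform JJ b z) <=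
  lq_const k q * (ln n%:R `^ (3 / q) * n%:R `^ (k%:R / 2 * ((q - 2) / q))).
Proof.
move=> q2 hz; have q0 : 0 < q by apply: lt_trans q2.
have [e [he hze]] := dyadic_rounding n3 q0 hz.
rewrite /lq_const gt_eqF // q2 /=; set th := 2 / q; set s := (1 - th) / 2.
have th01 : 0 < th < 1 by rewrite divr_gt0 //= ltr_pdivrMr // mul1r.
have s0 : 0 < s by rewrite divr_gt0 // subr_gt0; case/andP: th01.
have n0 : 0 < n%:R :> R by rewrite ltr0n; lia.
have f0 : 0 < k`!%:R :> R by rewrite ltr0n fact_gt0.
set B0 := 36 ^+ k * Num.sqrt (n%:R ^+ k / k`!%:R) : R.
set B1 := 36 ^+ k * (ln n%:R * Num.sqrt (ln n%:R)) : R.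
have B00 : 0 < B0 by rewrite mulr_gt0 ?exprn_gt0 // sqrtr_gt0 divr_gt0 ?exprn_gt0.
have B10 : 0 < B1 by rewrite !mulr_gt0 ?exprn_gt0 ?sqrtr_gt0.
have := @three_circles R n JJ b e 1 th B0 B1 ltr01 th01 B00 B10.
move=> /(_ _ _ z) h; apply: le_trans (h _ _ _) _ => {h}.
- by move=> y hy; apply: torus_bound => j; have := hy j; rewrite expr1n.
- by move=> y hy; apply: (l2_bound he) => j; have := hy j; rewrite div1r.
- by move=> j; rewrite mul1r /th -mulrN -four_powR.
rewrite -[leRHS]mulrA ler_wpM2l ?(ltW (three_circles_const_gt0 th01)) //.
have X0 : 0 < 36 ^+ k :> R by rewrite exprn_gt0.
have -> : B0 `^ (1 - th) * B1 `^ th = 36 ^+ k / (k`!%:R `^ s) *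
    (ln n%:R `^ (3 / q) * n%:R `^ (k%:R / 2 * ((q - 2) / q))).
  have root : Num.sqrt (n%:R ^+ k / k`!%:R) =
      n%:R `^ (k%:R / 2) * k`!%:R `^ (- 2^-1) :> R.
    rewrite sqrtrM ?exprn_ge0 // sqrtrV ?(ltW f0) // -!powR12_sqrt ?exprn_ge0 //.
    by rewrite -powR_mulrn // -powRrM -powRN.
  rewrite /B1 ln_three_halves ?(ltW lnp) // /B0 root {root}.
  rewrite !powRM ?mulr_ge0 ?powR_ge0 ?exprn_ge0 // -!powRrM -powRN.
  rewrite {3}(powR_split th X0).
  have -> : 3 / 2 * th = 3 / q by rewrite /th; field; rewrite gt_eqF.
  have -> : k%:R / 2 * (1 - th) = k%:R / 2 * ((q - 2) / q).
    by rewrite /th; field; rewrite gt_eqF.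
  have -> : - 2^-1 * (1 - th) = - s by rewrite /s; field.
  ring.
rewrite ler_wpM2r ?mulr_ge0 ?powR_ge0 //.
by apply: exp_growth_le_factorial.
Qed.

(** Interpolation between the [l_2] and the [l_1] balls, with
    [th = 2 / q - 1]. *)
Lemma lq_bound_lt2 (q : R) z : 1 < q < 2 -> lq_norm q z <= 1 ->
  normc (multiform JJ b z) <= lq_const k q * ln n%:R `^ ((3 * q - 3) / q).
Proof.
move=> /andP[q1 q2] hz; have q0 : 0 < q by apply: lt_trans q1.
have [e [he hze]] := dyadic_rounding n3 q0 hz.
rewrite /lq_const lt_eqF // (lt_gtF q2) q1 /=; set th := 2 / q - 1.
have th01 : 0 < th < 1.
  by rewrite subr_gt0 ltr_pdivlMr // mul1r q2 /= ltrBlDr ltr_pdivrMr //; lra.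
have f0 : 0 < k`!%:R :> R by rewrite ltr0n fact_gt0.
set B0 := 36 ^+ k * (ln n%:R * Num.sqrt (ln n%:R)) : R.
set B1 := 36 ^+ k / k`!%:R : R.
have B00 : 0 < B0 by rewrite !mulr_gt0 ?exprn_gt0 ?sqrtr_gt0.
have B10 : 0 < B1 by rewrite divr_gt0 ?exprn_gt0.
have half0 : 0 < (2^-1 : R) by rewrite invr_gt0.
have := @three_circles R n JJ b e 2^-1 th B0 B1 half0 th01 B00 B10.
move=> /(_ _ _ z) h; apply: le_trans (h _ _ _) _ => {h}.
- by move=> y hy; apply: (l2_bound he) => j; have := hy j.
- move=> y hy; apply: le_trans (l1_bound he _) _ => [j|].
    by apply: le_trans (hy j) _; rewrite -invfM -natrM.
  rewrite /B1 ler_pM2r ?invr_gt0 // lerXn2r ?nnegrE //; lra.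
- move=> j; apply: le_trans (hze j) _.
  rewrite four_powR -(powR_inv1 (ler0n R 2)) -powRD ?pnatr_eq0 ?implybT //.
  by rewrite (_ : 2 * - q^-1 = -1 + - th) // /th; ring.
rewrite -[leRHS]mulrA ler_wpM2l ?(ltW (three_circles_const_gt0 th01)) //.
have X0 : 0 < 36 ^+ k :> R by rewrite exprn_gt0.
have -> : B0 `^ (1 - th) * B1 `^ th = 36 ^+ k / (k`!%:R `^ th) *
    ln n%:R `^ ((3 * q - 3) / q).
  rewrite /B0 ln_three_halves ?(ltW lnp) // /B1 -(powR_inv1 (ltW f0)).
  rewrite !powRM ?powR_ge0 ?exprn_ge0 // -!powRrM -powRN.
  rewrite {3}(powR_split th X0).
  have -> : 3 / 2 * (1 - th) = (3 * q - 3) / q.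
    by rewrite /th; field; rewrite gt_eqF.
  rewrite mulN1r; ring.
rewrite ler_wpM2r ?powR_ge0 //.
by apply: exp_growth_le_factorial; case/andP: th01.
Qed.

Lemma lq_bound_eq2 z : lq_norm 2 z <= 1 ->
  normc (multiform JJ b z) <= lq_const k 2 * ln n%:R `^ (3 / 2).
Proof.
move=> hz; have [e [he hze]] := dyadic_rounding n3 (ltr0n R 2) hz.
rewrite /lq_const eqxx -ln_three_halves ?(ltW lnp) //.
apply: (l2_bound he) => j; apply: le_trans (hze j) _.
by rewrite four_powR mulrN mulfV // powR_inv1.
Qed.

Lemma lq_bound_eq1 z : lq_norm 1 z <= 1 -> normc (multiform JJ b z) <= lq_const k 1.
Proof.
move=> hz; have [e [he hze]] := dyadic_rounding n3 ltr01 hz.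
rewrite /lq_const ltxx; case: eqP => [|_]; first by lra.
case: (ltP 2 1) => [|_]; first by lra.
apply: le_trans (l1_bound he _) _ => [j|].
  by apply: le_trans (hze j) _; rewrite invr1 powR_inv1.
have := expR_ge1Dxn k.-1 (ler0n R 5); rewrite prednK ?(leq_trans _ k3) //.
by apply: le_trans; rewrite lerDr.
Qed.

End Normalized.
End Assembly.

Lemma coef_sup_norm_ge0 (R : realType) n (JJ : {set {set 'I_n}}) (a : {set 'I_n} -> R[i]) :
  0 <= coef_sup_norm JJ a.
Proof. exact: bigmax_ge_id. Qed.

Lemma coef_sup_norm_ge (R : realType) n (JJ : {set {set 'I_n}}) (a : {set 'I_n} -> R[i]) J :
  J \in JJ -> normc (a J) <= coef_sup_norm JJ a.
Proof. by move=> hJ; apply: (le_bigmax_cond _ (fun J => normc (a J))). Qed.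

Lemma poly_norm_le (R : realType) n (q B : R) (p : 'rV[R[i]]_n -> R[i]) :
  (forall z, lq_norm q z <= 1 -> normc (p z) <= B) -> (poly_norm q p <= B%:E)%E.
Proof.
move=> h; apply: ge_ereal_sup => _ [z /= hz <-].
by rewrite lee_fin h.
Qed.

Theorem theorem10 (R : realType) :
  exists A : nat -> R -> R,
    (forall (k : nat) (q : R), 0 < A k q) /\
    (forall (k k' : nat) (q : R), q != 2 -> A k q = A k' q) /\
    forall (n k : nat) (JJ : {set {set 'I_n}}) (a : {set 'I_n} -> R[i]),
      (3 <= k)%N -> (k <= n)%N -> partial_steiner (k - 1) k JJ ->
      exists c : {set 'I_n} -> R[i],
        (forall J : {set 'I_n}, J \in JJ -> c J = 1 \/ c J = -1) /\
        forall q : R,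
          (2 <= q ->
             (poly_norm q (signed_poly JJ c a) <=
              (A k q * (coef_sup_norm JJ a * ln n%:R `^ (3 / q)
                        * n%:R `^ (k%:R / 2 * ((q - 2) / q))))%:E)%E) /\
          (1 <= q <= 2 ->
             (poly_norm q (signed_poly JJ c a) <=
              (A k q * (coef_sup_norm JJ a
                        * ln n%:R `^ ((3 * q - 3) / q)))%:E)%E).
Proof.
exists (@lq_const R); split; first exact: lq_const_gt0.
split=> [k k' q q2|n k JJ a k3 kn steiner].
  by rewrite /lq_const (negPf q2).
set al := coef_sup_norm JJ a.
have al0 : 0 <= al by apply: coef_sup_norm_ge0.
pose a1 J := (al^-1)%:C * a J.
have a1_le1 J : J \in JJ -> normc (a1 J) <= 1.
  move=> hJ; rewrite /a1 normcM normc_real ger0_norm ?invr_ge0 //.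
  move: al0; rewrite le_eqVlt => /orP[/eqP <-|alp]; first by rewrite invr0 mul0r.
  by rewrite mulrC ler_pdivrMr // mul1r coef_sup_norm_ge.
have [c [hc torus l2]] := good_signs k3 kn steiner a1_le1.
exists c; split=> [J _|q]; first exact: hc.
set b := fun J => c J * a1 J in torus l2.
have hb J : J \in JJ -> normc (b J) <= 1.
  by move=> hJ; rewrite /b normcM; case: (hc J) => ->; rewrite ?normcN normc1 mul1r a1_le1.
have rescale z : normc (signed_poly JJ c a z) = al * normc (multiform JJ b z).
  rewrite -[al in RHS]ger0_norm // -normc_real -normcM /multiform mulr_sumr.
  congr normc; apply: eq_bigr => J hJ.
  have key : al%:C * a1 J = a J.
    have [alz|aln] := eqVneq al 0; last first.
      by rewrite /a1 mulrA -(rmorphM (real_complex R)) /= mulfV // mul1r.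
    have /eq0_normc a0 : normc (a J) = 0.
      by apply/eqP; rewrite eq_le normc_ge0 -alz coef_sup_norm_ge.
    by rewrite /a1 a0 !mulr0.
  by rewrite /b -key; ring.
have hk := steiner.1.
have gt2 := lq_bound_gt2 k3 kn torus l2.
have lt2 := lq_bound_lt2 k3 kn hk hb l2.
have eq2 := lq_bound_eq2 k3 kn l2.
have eq1 := lq_bound_eq1 k3 kn hk hb.
split=> hq; apply: poly_norm_le => z hz; rewrite rescale.
  rewrite -[al * _ * _]mulrA [leRHS]mulrCA ler_wpM2l //; move: hq;
  rewrite le_eqVlt => /orP[/eqP q2|q2]; last exact: gt2.
  by subst q; rewrite subrr mul0r mulr0 powRr0 mulr1; apply: eq2.
rewrite [leRHS]mulrCA ler_wpM2l //; case/andP: hq.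
rewrite le_eqVlt => /orP[/eqP q1 _|q1].
  by subst q; rewrite mulr1 subrr mul0r powRr0 mulr1; apply: eq1.
rewrite le_eqVlt => /orP[/eqP q2|q2]; last by apply: lt2 => //; rewrite q1.
by subst q; rewrite (_ : 3 * 2 - 3 = 3); [exact: eq2 | ring].
Qed.
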